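(* Let $C$ be a convex subset of $\mathbb{R}^n$ and let $f:\mathbb{R}^n\times\mathbb{R}^n\to\mathbb{R}$ be a bifunction such that at least one of the following assumptions holds: 1. $f(\cdot,y)$ is lower semicontinuous for all $y\in C$; 2. $f(x,\cdot)$ is upper semicontinuous for all $x\in C$; 3. $f$ vanishes on the diagonal of $C$ (that is, $f(x,x)=0$ for all $x\in C$) and $-f(\cdot,y)$ is semistrictly quasiconvex for all $y\in C$; 4. $f$ vanishes on the diagonal of $C$ and $f(x,\cdot)$ is semistrictly quasiconvex for all $x\in C$. If $-f$ is pseudomonotone (on $\mathbb{R}^n$), then $f$ has the upper sign property on $C$.
   Context: A bifunction $g$ is pseudomonotone on $\mathbb{R}^n$ if for all $x,y\in\mathbb{R}^n$, $g(x,y)\ge0\Rightarrow g(y,x)\le0$. $f$ has the upper sign property on a convex set $C$ if for all $x,y\in C$, with $x_t=(1-t)x+ty$: ($f(x_t,x)\le0$ for all $t\in]0,1[$) implies $f(x,y)\ge0$. A function $h:\mathbb{R}^n\to\mathbb{R}$ is quasiconvex if $h((1-t)x+ty)\le\max\{h(x),h(y)\}$ for all $x,y\in\mathbb{R}^n$, $t\in[0,1]$; it is semistrictly quasiconvex if it is quasiconvex and, for all $x,y\in\mathbb{R}^n$ with $h(x)\ne h(y)$, $h((1-t)x+ty)<\max\{h(x),h(y)\}$ for all $t\in]0,1[$. *)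

(* Defs.v *)
From mathcomp Require Import all_boot all_order all_algebra.
From mathcomp Require Import all_classical all_reals all_analysis.

Set Implicit Arguments.
Unset Strict Implicit.
Unset Printing Implicit Defensive.

Import Order.TTheory GRing.Theory Num.Theory.
Import numFieldNormedType.Exports.

Local Open Scope classical_set_scope.
Local Open Scope ring_scope.

(* The order dual of the library's [lower_semicontinuous]. *)
Definition upper_semicontinuous (X : topologicalType) (R : numFieldType)
    (h : X -> \bar R) : Prop :=
  forall x a, (h x < a%:E)%E ->
    exists2 V, nbhs x V & forall y, V y -> (h y < a%:E)%E.

Definition pseudomonotone (R : realType) (n : nat)
    (g : 'rV[R]_n -> 'rV[R]_n -> R) : Prop :=
  forall x y, 0 <= g x y -> g y x <= 0.

Definition upper_sign_property (R : realType) (n : nat) (C : set 'rV[R]_n)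
    (f : 'rV[R]_n -> 'rV[R]_n -> R) : Prop :=
  forall x y, C x -> C y ->
    (forall t : R, 0 < t -> t < 1 -> f ((1 - t) *: x + t *: y) x <= 0) ->
    0 <= f x y.

Definition quasiconvex (R : realType) (n : nat) (h : 'rV[R]_n -> R) : Prop :=
  forall (x y : 'rV[R]_n) (t : R), 0 <= t -> t <= 1 ->
    h ((1 - t) *: x + t *: y) <= Num.max (h x) (h y).

Definition semistrictly_quasiconvex (R : realType) (n : nat)
    (h : 'rV[R]_n -> R) : Prop :=
  quasiconvex h /\
  forall x y : 'rV[R]_n, h x <> h y -> forall t : R, 0 < t -> t < 1 ->
    h ((1 - t) *: x + t *: y) < Num.max (h x) (h y).

Definition vanishes_on_diagonal (R : realType) (n : nat) (C : set 'rV[R]_n)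
    (f : 'rV[R]_n -> 'rV[R]_n -> R) : Prop :=
  forall x, C x -> f x x = 0.

(* Main.v *)
(** Suppose [f x y < 0], and let [x_t] run along the open segment from [x] to
    [y]. Pseudomonotonicity of [-f] gives [f y x > 0], while the premise of the
    upper sign property says [f x_t x <= 0] and hence, by pseudomonotonicity
    again, [f x x_t >= 0]. In the semicontinuous cases the strict signs of
    [f y x] and [f x y] at the endpoint [y] persist at some [x_t] close to [y];
    in the semistrictly quasiconvex cases they propagate to the midpoint, since
    the value at the other endpoint [x] is [f x x = 0]. *)

Require Import Defs.
From mathcomp Require Import all_boot all_order all_algebra.
From mathcomp Require Import all_classical all_reals all_analysis.
Import Order.TTheory GRing.Theory Num.Theory.
Import numFieldNormedType.Exports.

Local Open Scope classical_set_scope.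
Local Open Scope ring_scope.

(** By continuity the point tends to [y] as [t] tends to 1; the left-sided limit keeps [t] below
    1. *)
Lemma nbhs_segment (R : realType) (V : normedModType R) (x y : V)
    (A : set V) :
  nbhs y A -> exists t : R, [/\ 0 < t, t < 1 & A ((1 - t) *: x + t *: y)].
Proof.
move=> yA.
have cvg_seg : (1 - t) *: x + t *: y @[t --> (1 : R)^'-] --> y.
  rewrite -[X in _ --> X](_ : (1 - 1 : R) *: x + 1 *: y = y); last first.
    by rewrite subrr scale0r add0r scale1r.
  apply: cvg_at_left_filter; apply: cvgD; apply: cvgZr_tmp.
  - by apply: cvgB; [exact: cvg_cst|exact: cvg_id].
  - exact: cvg_id.
have : \forall t \near (1 : R)^'-,
    [/\ 0 < t, t < 1 & A ((1 - t) *: x + t *: y)].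
  near=> t; split; near: t.
  - exact: nbhs_left_gt.
  - exact: nbhs_left_lt.
  - exact: cvg_seg.
by move=> /filter_ex.
Unshelve. all: by end_near. Qed.

Theorem proposition3p2 (R : realType) (n : nat) (C : set 'rV[R]_n)
    (f : 'rV[R]_n -> 'rV[R]_n -> R)
    (convC : convex_set (C : set (convex_lmodType 'rV[R]_n)))
    (hyp :
      (forall y, C y -> lower_semicontinuous (fun x => (f x y)%:E))
      \/ (forall x, C x -> upper_semicontinuous (fun y => (f x y)%:E))
      \/ (vanishes_on_diagonal C f /\
          forall y, C y -> semistrictly_quasiconvex (fun x => - f x y))
      \/ (vanishes_on_diagonal C f /\
          forall x, C x -> semistrictly_quasiconvex (fun y => f x y)))
    (pmN : pseudomonotone (fun x y => - f x y)) :
  upper_sign_property C f.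
Proof.
move=> x y Cx Cy fle0; rewrite leNgt; apply/negP => fxy_lt0.
have pm u v : f u v <= 0 -> 0 <= f v u.
  by move=> fuv; have := pmN u v; rewrite oppr_ge0 oppr_le0; exact.
have fyx_gt0 : 0 < f y x.
  by rewrite ltNge; apply/negP => /pm; rewrite leNgt fxy_lt0.
have half0 : 0 < 2^-1 :> R by rewrite invr_gt0.
have half1 : 2^-1 < 1 :> R by rewrite invf_lt1 // ltr1n.
have [lsc|[usc|[[diag qcx]|[diag qcx]]]] := hyp.
- have [|A /(nbhs_segment _ _ x)[t [t0 t1 At]] Apos] := lsc x Cx y 0.
    by rewrite lte_fin.
  by have := Apos _ At; rewrite lte_fin ltNge fle0.
- have [|A /(nbhs_segment _ _ x)[t [t0 t1 At]] Aneg] := usc x Cx y 0.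
    by rewrite lte_fin.
  by have := Aneg _ At; rewrite lte_fin ltNge pm // fle0.
(* The larger endpoint value is [- f x x = 0], so [f _ x] is positive at the midpoint, against
   [fle0]. *)
- have neq : - f x x <> - f y x.
    by rewrite diag // oppr0 => /esym/eqP; rewrite oppr_eq0 gt_eqF.
  have := (qcx x Cx).2 x y neq _ half0 half1.
  by rewrite diag // oppr0 max_l ?oppr_le0 ?ltW// oppr_lt0 ltNge fle0.
(* Now the maximum is [f x x = 0], so [f x] is negative at the midpoint, against [pm] combined with
   [fle0]. *)
- have neq : f x x <> f x y.
    by rewrite diag // => /esym/eqP; rewrite lt_eqF.
  have := (qcx x Cx).2 x y neq _ half0 half1.
  by rewrite diag // max_l ?ltW// ltNge pm // fle0.
Qed.
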